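(* Let $I=(\{1,\ldots,n\},\preceq_I)$ be a finite connected poset and let $\mathcal H(I)$ be its Hasse digraph. (a) $I$ is non-negative with $\mathrm{crk}_I=0$ and $\mathrm{Dyn}_I=\mathbb A_n$ if and only if $\mathcal H(I)$ is an oriented path, i.e. the underlying undirected graph of $\mathcal H(I)$ is a path graph (the arrows may be oriented arbitrarily). (b) $I$ is non-negative with $\mathrm{crk}_I=1$ and $\mathrm{Dyn}_I=\mathbb A_{n-1}$ if and only if $\mathcal H(I)$ is $2$-regular (every vertex has degree $2$ in the underlying undirected graph) and $\mathcal H(I)$ has at least two sinks. (c) If $I$ is non-negative and $\mathrm{Dyn}_I=\mathbb A_{n-\mathrm{crk}_I}$, then $\mathrm{crk}_I\le 1$.
   Context: For a finite poset $I=(\{1,\dots,n\},\preceq_I)$: its incidence matrix is $C_I=[c_{ij}]\in M_n(\mathbb Z)$ with $c_{ij}=1$ if $i\preceq_I j$ and $c_{ij}=0$ otherwise; its symmetric Gram matrix is $G_I=\tfrac12(C_I+C_I^{tr})$ and its quadratic form is $q_I(v)=vG_Iv^{tr}$ for $v\in\mathbb Z^n$. $I$ is non-negative of corank $\mathrm{crk}_I=r$ if $G_I$ is positive semi-definite of rank $n-r$. The Hasse digraph $\mathcal H(I)$ has vertices $1,\dots,n$ and an arrow $i\to j$ iff $i\preceq_I j$, $i\ne j$, and there is no $k\notin\{i,j\}$ with $i\preceq_I k\preceq_I j$. $I$ is connected if the underlying undirected graph of $\mathcal H(I)$ is connected. A sink of a digraph is a vertex that is the tail of no arrow. Simply-laced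 Dynkin diagrams (as graphs): $\mathbb A_m$ ($m\ge1$) is the path on $m$ vertices; $\mathbb D_m$ ($m\ge4$) is a path on $m-1$ vertices with one extra vertex attached to the second vertex; $\mathbb E_6,\mathbb E_7,\mathbb E_8$ are the trees with one branching vertex and three arms having $1,2,2$, resp. $1,2,3$, resp. $1,2,4$ vertices. For a graph $\Gamma$ on $m$ vertices put $G_\Gamma=E_m-\tfrac12\mathrm{Adj}(\Gamma)$. Dynkin type: if $I$ is connected and non-negative of corank $r$, then $\mathrm{Ker}\,q_I=\{v\in\mathbb Z^n: q_I(v)=0\}$ is a free abelian group of rank $r$ and there are indices $k_1<\dots<k_r$ and a $\mathbb Z$-basis $h^{(1)},\dots,h^{(r)}$ of $\mathrm{Ker}\,q_I$ with $h^{(i)}_{k_j}=\delta_{ij}$; the subposet $I'=I\setminus\{k_1,\dots,k_r\}$ (with $I'=I$ if $r=0$) is connected and positive, and there is a unique $D\in\{\mathbb A_{n-r},\mathbb D_{n-r},\mathbb E_6,\mathbb E_7,\mathbb E_8\}$ on $n-r$ vertices with $G_{I'}=B^{tr}G_DB$ for some $B\in GL(n-r,\mathbb Z)$; $\mathrm{Dyn}_I:=D$ (this is independent of the choices). *)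

(* Defs.v *)
From HB Require Import structures.
From mathcomp Require Import all_boot all_order all_fingroup all_algebra.
Set Implicit Arguments. Unset Strict Implicit. Unset Printing Implicit Defensive.
Import Order.TTheory GRing.Theory Num.Theory.
Local Open Scope ring_scope.

Definition is_poset (n : nat) (le : rel 'I_n) : Prop :=
  [/\ reflexive le, antisymmetric le & transitive le].

Definition incmx (n : nat) (le : rel 'I_n) : 'M[int]_n :=
  \matrix_(i, j) (le i j)%:R.

Definition gram (n : nat) (le : rel 'I_n) : 'M[rat]_n :=
  2^-1 *: (map_mx (fun z : int => z%:~R) (incmx le + (incmx le)^T)).

Definition intmx (m n : nat) (A : 'M[int]_(m, n)) : 'M[rat]_(m, n) :=
  map_mx (fun z : int => z%:~R) A.

Definition qform (n : nat) (le : rel 'I_n) (v : 'rV[int]_n) : rat :=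
  (intmx v *m gram le *m (intmx v)^T) 0 0.

Definition psd (n : nat) (G : 'M[rat]_n) : Prop :=
  forall v : 'rV[rat]_n, 0 <= (v *m G *m v^T) 0 0.

Definition nonneg (n : nat) (le : rel 'I_n) : Prop := psd (gram le).

(* corank: crk_I = n - rank G_I  (meaningful for non-negative I) *)
Definition crk (n : nat) (le : rel 'I_n) : nat := (n - \rank (gram le))%N.

Definition hasse_arrow (n : nat) (le : rel 'I_n) (i j : 'I_n) : bool :=
  [&& le i j, i != j &
      [forall k, ~~ [&& k != i, k != j, le i k & le k j]]].

Definition hasse_adj (n : nat) (le : rel 'I_n) : rel 'I_n :=
  fun i j => hasse_arrow le i j || hasse_arrow le j i.

Definition poset_connected (n : nat) (le : rel 'I_n) : Prop :=
  forall i j : 'I_n, connect (hasse_adj le) i j.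

Definition path_adj (m : nat) : rel 'I_m :=
  fun i j => (i.+1 == j :> nat) || (j.+1 == i :> nat).

Definition hasse_is_path (n : nat) (le : rel 'I_n) : Prop :=
  exists p : {perm 'I_n},
    forall i j : 'I_n, hasse_adj le (p i) (p j) = path_adj i j.

Definition hasse_2regular (n : nat) (le : rel 'I_n) : Prop :=
  forall i : 'I_n, #|[set j | hasse_adj le i j]| = 2%N.

Definition is_sink (n : nat) (le : rel 'I_n) (i : 'I_n) : bool :=
  [forall j, ~~ hasse_arrow le i j].

Definition at_least_two_sinks (n : nat) (le : rel 'I_n) : Prop :=
  (2 <= #|[set i | is_sink le i]|)%N.

Definition gramA (m : nat) : 'M[rat]_m :=
  \matrix_(i, j) ((i == j)%:R - 2^-1 * (path_adj i j)%:R).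

(* Dyn_I = A_m, following the paper's definition: there are indices
   K = {k_1,..,k_r} (r = crk_I) and a Z-basis (h^(k))_{k in K} of
   Ker q_I with h^(k)_{k'} = delta_{k k'}; the subposet I' = I \ K
   (enumerated by an injection f : 'I_m -> 'I_n onto the complement of K)
   has Gram matrix Z-congruent to G_{A_m}. *)
Definition DynA (n : nat) (le : rel 'I_n) (m : nat) : Prop :=
  (0 < m)%N /\ (m + crk le)%N = n /\
  exists (K : {set 'I_n}) (h : 'I_n -> 'rV[int]_n),
    [/\ #|K| = crk le,
        (forall k, k \in K -> qform le (h k) = 0),
        (forall k k', k \in K -> k' \in K -> h k 0 k' = (k == k')%:R),
        (forall v : 'rV[int]_n, qform le v = 0 ->
           exists c : 'I_n -> int, v = \sum_(k in K) c k *: h k) &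
        exists f : 'I_m -> 'I_n,
          [/\ injective f, (forall i, f i \notin K) &
              exists B : 'M[int]_m, B \in unitmx /\
                \matrix_(i, j) gram le (f i) (f j)
                  = (intmx B)^T *m gramA m *m intmx B]].

(* Main.v *)
Require Import Defs.
From mathcomp Require Import all_boot all_order all_fingroup all_algebra.
From mathcomp Require Import zify ring.
Set Implicit Arguments. Unset Strict Implicit. Unset Printing Implicit Defensive.
Import Order.TTheory GRing.Theory Num.Theory.

(* If Dyn_I = A_m, then modulo the radical every point of I becomes a root
   e_a - e_c of the lattice A_m = {x in Z^(m+1) | sum x = 0}, and two distinct
   points are comparable iff their roots have inner product 1.  Hence the
   comparability graph is claw-free and diamond-free: of three neighbours of an
   edge two share one of its ends and so are comparable, and similarly for a
   diamond.  This forces every point to have degree at most 2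
   in the Hasse diagram, which is therefore a path or a cycle; a cycle with a
   single sink contains a diamond.
   Conversely, the points of a zigzag path are realised as the edges of a tree
   on m+1 vertices in which every monotone run is a star; the centres of the
   first and the last run, joined by one more edge, realise a sink that closes
   the path into a cycle with at least two sinks. *)

(** * Connected graphs of maximal degree two *)

Lemma card_le2_mem (T : finType) (A : {pred T}) (a b y : T) :
  #|A| <= 2 -> a != b -> a \in A -> b \in A -> y \in A -> y = a \/ y = b.
Proof.
move=> A2 ab aA bA yA; case: (eqVneq y a) => [->|ya]; first by left.
case: (eqVneq y b) => [->|yb]; first by right.
have /card_uniqP U : uniq [:: y; a; b] by rewrite /= !inE negb_or ya yb ab.
suff : #|[:: y; a; b]| <= #|A| by rewrite U /=; lia.
by apply/subset_leq_card/subsetP => x; rewrite !inE => /or3P [] /eqP ->.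
Qed.

(** A longest simple path from [z] works. By maximality the neighbours of its last vertex lie on it,
    and an inner vertex has used up its degree on the path, so the path is closed under adjacency
    and exhausts the connected graph. *)
Lemma degree_le2_enum (T : finType) (e : rel T) (z : T) :
  symmetric e -> irreflexive e -> (forall x y, connect e x y) ->
  (forall x, #|e x| <= 2) -> #|e z| <= 1 \/ (forall x, #|e x| = 2) ->
  exists s, [/\ uniq (z :: s), path e z s, (forall x, x \in z :: s) &
    forall i j, i < j <= size s -> e (nth z (z :: s) i) (nth z (z :: s) j) ->
      j = i.+1 \/ i = 0 /\ j = size s].
Proof.
move=> esym eirr econ deg2 degz.
pose P k := [exists t : k.-tuple T, uniq (z :: t) && path e z t].
have exP : exists k, P k by exists 0; apply/existsP; exists [tuple].
have leP k : P k -> k <= #|T|.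
  case/existsP=> t /andP [/andP [_ /card_uniqP U] _].
  by move: (max_card (mem t)); rewrite U size_tuple.
case: (ex_maxnP exP leP) => k /existsP [t /andP [Ut pt]] kmax.
exists t; set l := size t; pose x i := nth z (z :: t) i.
have xE i j : i <= l -> j <= l -> x i = x j -> i = j.
  by move=> il jl /eqP; rewrite /x nth_uniq //= ?ltnS // => /eqP.
have xin i : i <= l -> x i \in z :: t by move=> il; apply: mem_nth; rewrite /= ltnS.
have xadj i : i < l -> e (x i) (x i.+1).
  by move=> il; move/(pathP z): pt => /(_ i il).
have lastE : last z t = x l by rewrite (last_nth z).
have lastmax y : e (x l) y -> y \in z :: t.
  move=> exy; case: (boolP (y \in z :: t)) => // yt.
  suff /kmax : P k.+1 by rewrite ltnn.
  have sz : size (rcons t y) == k.+1 by rewrite size_rcons size_tuple.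
  apply/existsP; exists (Tuple sz).
  rewrite -rcons_cons rcons_uniq yt Ut /= rcons_path pt lastE exy //.
have xint i y : 0 < i < l -> e (x i) y -> y = x i.-1 \/ y = x i.+1.
  case: i => // i /= il ey; apply: (card_le2_mem (deg2 (x i.+1))) => //.
  - by apply/negP => /eqP /xE; lia.
  - by rewrite unfold_in esym xadj //; lia.
  - by rewrite unfold_in xadj.
have zmax y : e z y -> y \in z :: t.
  move=> ezy; case: (posnP l) => [l0|lgt0].
    by apply: lastmax; rewrite l0.
  case: degz => [deg1|deg2e].
    suff -> : y = x 1 by apply: xin.
    by move: deg1 => /card_le1_eqP; apply=> //; apply: (xadj 0).
  (* In the regular case the last vertex has a second neighbour on the path. Inner vertices are
     saturated, so it is [z], whose two neighbours are then [x 1] and [x l]. *)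
  have [y' ey' ny'] : exists2 y', e (x l) y' & y' != x l.-1.
    have l1in : x l.-1 \in e (x l).
      by rewrite unfold_in esym -[in X in _ (x X)](prednK lgt0) xadj // ltn_predL.
    have := deg2e (x l); rewrite (cardD1 (x l.-1)) l1in => /eqP.
    rewrite eqSS => /eqP c1.
    have /card_gt0P [y'] : 0 < #|[predD1 e (x l) & x l.-1]| by rewrite c1.
    by rewrite inE => /andP [ny ein]; exists y'.
  have : y' \in z :: t by apply: lastmax.
  move=> /(nthP z) [i]; rewrite /= ltnS -/l => il; rewrite -/(x i) => xi.
  have inl : i <> l by move=> E; move: ey'; rewrite -xi E eirr.
  have inl1 : i <> l.-1 by move=> E; move: ny'; rewrite -xi E eqxx.
  case: (posnP i) => [i0|igt0]; last first.
    have := xint i (x l); rewrite esym xi => /(_ _ ey') [|E|E]; first by lia.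
    + by move/xE: E; lia.
    + by move/xE: E; lia.
  have [||||E|E] := @card_le2_mem _ _ (x 1) (x l) y (deg2 z).
  - by apply/negP => /eqP /xE; lia.
  - by apply: (xadj 0).
  - by rewrite unfold_in esym -[z]/(x 0) -i0 xi.
  - exact: ezy.
  - by rewrite E; apply: xin.
  - by rewrite E; apply: xin.
have tall y : y \in z :: t.
  have csym : connect_sym e by apply: sym_connect_sym.
  suff cl : closed e (mem (z :: t)).
    by have := closed_connect cl (econ z y); rewrite !inE eqxx /= => <-.
  apply: intro_closed => // u v euv /(nthP z) [i].
  rewrite /= ltnS -/l -/(x i) => il xi.
  case: (posnP i) => [i0|igt0]; first by apply: zmax; move: euv; rewrite -xi i0.
  case: (eqVneq i l) => [E|nil]; first by apply: lastmax; rewrite -E xi.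
  by case: (xint i v); rewrite ?xi //; first lia; move=> ->; apply: xin; lia.
split=> // i j /andP [ij jl] eij.
case: (posnP i) => [i0|igt0]; last first.
  by left; case: (xint i (x j)) => //; first lia; move/xE; lia.
case: (eqVneq j l) => [->|njl]; first by right.
by left; case: (xint j (x i)); rewrite 1?esym //; first lia; move/xE; lia.
Qed.

(** * Hasse diagrams *)

Section Hasse.
Variables (n : nat) (le : rel 'I_n).
Hypothesis Hposet : is_poset le.

(** Induction on the size of the interval from [x] to [y]: a point strictly between them splits it
    into two smaller intervals. *)
Lemma le_hasse_connect x y : le x y -> connect (hasse_arrow le) x y.
Proof.
case: Hposet => lexx lea let'.
have [k] := ubnP #|[set u | le x u && le u y]|; elim: k x y => // k IH x y /ltnSE lek xy.
case: (eqVneq x y) => [->|nxy]; first exact: connect0.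
case: (boolP (hasse_arrow le x y)) => [/connect1 //|].
rewrite /hasse_arrow xy nxy /= => /forallPn [w]; rewrite negbK => /and4P [wx wy xw wz].
apply: (connect_trans (y := w)); apply: IH => //.
  apply: leq_trans lek; apply: proper_card; apply/properP; split.
    by apply/subsetP => u; rewrite !inE => /andP [-> uw]; apply: let' wz.
  exists y; rewrite !inE ?xy ?lexx //=; apply/negP => yw.
  by move/eqP: wy; apply; apply: lea; rewrite wz.
apply: leq_trans lek; apply: proper_card; apply/properP; split.
  by apply/subsetP => u; rewrite !inE => /andP [wu ->]; rewrite (let' _ _ _ xw wu).
exists x; rewrite !inE ?xy ?lexx ?andbT //=; apply/negP => wx'.
by move/eqP: wx; apply; apply: lea; rewrite wx'.
Qed.

Lemma hasse_adj_sym : symmetric (hasse_adj le).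
Proof. by move=> x y; rewrite /hasse_adj orbC. Qed.

Lemma hasse_adj_irr : irreflexive (hasse_adj le).
Proof. by move=> x; rewrite /hasse_adj /hasse_arrow eqxx andbF. Qed.

Lemma hasse_arrow_le x y : hasse_arrow le x y -> le x y.
Proof. by case/and3P. Qed.

Lemma hasse_arrow_neq x y : hasse_arrow le x y -> x != y.
Proof. by case/and3P. Qed.

Lemma sink_max x y : is_sink le x -> le x y -> x = y.
Proof.
move=> /forallP sx /le_hasse_connect /connectP [[|w s] /= + ->] //.
by rewrite (negbTE (sx w)).
Qed.

Lemma ex_sink x : exists2 y, is_sink le y & le x y.
Proof.
case: Hposet => lexx lea let'.
have [k] := ubnP #|[set u | le x u]|; elim: k x => // k IH x /ltnSE lek.
case: (boolP (is_sink le x)) => [sx|/forallPn [y]]; first by exists x.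
rewrite negbK => axy; have xy := hasse_arrow_le axy.
case: (IH y) => [|w sw yw]; last by exists w => //; apply: let' yw.
apply: leq_trans lek; apply: proper_card; apply/properP; split.
  by apply/subsetP => u; rewrite !inE; apply: let'.
exists x; rewrite !inE ?lexx //; apply/negP => yx.
by move/eqP: (hasse_arrow_neq axy); apply; apply: lea; rewrite xy.
Qed.

Lemma covers_incomparable x y z :
  hasse_arrow le x y -> hasse_arrow le x z -> y != z -> ~~ le y z.
Proof.
move=> /and3P [xy nxy _] /and3P [xz nxz /forallP /(_ y)] H nyz.
by apply: contra H => yz; rewrite eq_sym nxy nyz xy yz.
Qed.

Lemma cocovers_incomparable x y z :
  hasse_arrow le y x -> hasse_arrow le z x -> y != z -> ~~ le y z.
Proof.
move=> /and3P [yx nyx /forallP /(_ z) H] /and3P [zx nzx _] nyz.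
by apply: contra H => yz; rewrite nzx yz zx eq_sym nyz.
Qed.

End Hasse.

Local Open Scope ring_scope.

(** * Root realisations of Gram matrices *)

Lemma dot_ge0 (F : realFieldType) n (u : 'rV[F]_n) : 0 <= (u *m u^T) 0 0.
Proof. by rewrite mxE; apply: sumr_ge0 => i _; rewrite mxE -expr2 sqr_ge0. Qed.

Lemma dot_eq0 (F : realFieldType) n (u : 'rV[F]_n) : (u *m u^T) 0 0 = 0 -> u = 0.
Proof.
rewrite mxE => /eqP; rewrite psumr_eq0 => [/allP u0|i _].
  apply/rowP => i; have := u0 i (mem_index_enum _).
  by rewrite !mxE -expr2 sqrf_eq0 => /eqP.
by rewrite mxE -expr2 sqr_ge0.
Qed.

(** With [w = v G], the form at [w + t v] is affine in [t] with slope [2 |w|^2], because [v] is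
    isotropic; non-negativity for every [t] forces [w = 0]. *)
Lemma psd_radical n (G : 'M[rat]_n) (v : 'rV[rat]_n) :
  psd G -> G^T = G -> (v *m G *m v^T) 0 0 = 0 -> v *m G = 0.
Proof.
move=> psdG symG v0; apply: dot_eq0; set w := v *m G.
have wE : w *m w^T = v *m G *m w^T by [].
have wE' : w *m G *m v^T = w *m w^T.
  by rewrite /w trmx_mul symG !mulmxA.
set c := (w *m w^T) 0 0; set d := (w *m G *m w^T) 0 0.
have key (t : rat) : 0 <= d + 2 * t * c.
  have := psdG (w + t *: v).
  rewrite linearD linearZ /= !mulmxDl !mulmxDr.
  rewrite -!scalemxAl -!scalemxAr wE' -/w mxE [X in X + _]mxE [X in _ + X]mxE.
  rewrite [X in _ + X + _]mxE [X in _ + (X + _)]mxE [X in _ + (_ + X)]mxE.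
  rewrite [X in _ + (_ + t * X)]mxE v0.
  rewrite -/c -/d => /le_trans; apply; rewrite le_eqVlt; apply/orP; left.
  by apply/eqP; ring.
have c0 : 0 <= c := dot_ge0 w.
apply/eqP; rewrite eq_le c0 andbT leNgt; apply/negP => cgt0.
(* The value of [t] at which the affine function equals -1. *)
have := key (- (d + 1) / (2 * c)).
have -> : d + 2 * (- (d + 1) / (2 * c)) * c = -1.
  by field; rewrite gt_eqF.
by [].
Qed.

Lemma intmx_mul m n p (A : 'M[int]_(m, n)) (B : 'M[int]_(n, p)) :
  intmx (A *m B) = intmx A *m intmx B.
Proof. exact: map_mxM. Qed.

Lemma intmx_tr m n (A : 'M[int]_(m, n)) : intmx A^T = (intmx A)^T.
Proof. by rewrite /intmx map_trmx. Qed.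

Lemma intmx_inj m n : injective (@intmx m n).
Proof.
move=> A B /matrixP AB; apply/matrixP => i j; have := AB i j.
by rewrite !mxE => /eqP; rewrite eqr_int => /eqP.
Qed.

Lemma intmx0 m n : intmx (0 : 'M_(m, n)) = 0.
Proof. by apply/matrixP => i j; rewrite !mxE. Qed.

Lemma intmx1 n : intmx (1%:M : 'M_n) = 1%:M.
Proof. exact: map_mx1. Qed.

(* Row [k] is the simple root [e_k - e_(k+1)] of the root lattice
   [A_m = {x in Z^(m+1) | sum x = 0}]. *)
Definition simple_roots m : 'M[int]_(m, m.+1) :=
  \matrix_(k, l) ((l == k :> nat)%:R - (l == k.+1 :> nat)%:R).

Lemma sum_delta (R : pzRingType) m (F : nat -> R) a : (a <= m)%N ->
  \sum_(l < m.+1) (l == a :> nat)%:R * F l = F a.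
Proof.
move=> am; rewrite (bigD1 (Ordinal (am : a < m.+1)%N)) //= eqxx mul1r big1 ?addr0 //.
by move=> l; rewrite -val_eqE /= => /negbTE ->; rewrite mul0r.
Qed.

Lemma sum_delta2 (R : pzRingType) m (F : nat -> R) a b : (a <= m)%N -> (b <= m)%N ->
  \sum_(l < m.+1) ((l == a :> nat)%:R - (l == b :> nat)%:R) * F l = F a - F b.
Proof.
move=> am bm; under eq_bigr do rewrite mulrBl.
by rewrite sumrB !sum_delta.
Qed.

Lemma gramA_simple_roots m :
  gramA m = 2^-1 *: intmx (simple_roots m *m (simple_roots m)^T).
Proof.
apply/matrixP => i j; rewrite !mxE.
under eq_bigr do rewrite 3!mxE.
rewrite (sum_delta2 (fun l => (l == j :> nat)%:R - (l == j.+1 :> nat)%:R : int)) //; last exact: ltnW.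
rewrite -val_eqE /path_adj eqSS [(j.+1 == i)%N]eq_sym.
case: (ltngtP i j) => //= [ij|ij|<-].
- have -> : (nat_of_ord i == j.+1) = false by lia.
  by case: (_ == _).
- have -> : (i.+1 == nat_of_ord j) = false by lia.
  by case: (_ == _).
- have -> : (nat_of_ord i == i.+1) = false by lia.
  by have -> : (i.+1 == nat_of_ord i) = false by lia.
Qed.

Lemma simple_roots_free m (v : 'rV[rat]_m) : v *m intmx (simple_roots m) = 0 -> v = 0.
Proof.
(* [E] takes partial sums of coordinates, which recovers the coefficients over the simple roots. *)
pose E : 'M[int]_(m.+1, m) := \matrix_(l, k) (l <= k)%:R.
have DE : simple_roots m *m E = 1%:M.
  apply/matrixP => k k'; rewrite !mxE.
  under eq_bigr do rewrite 2!mxE.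
  rewrite (sum_delta2 (fun l => (l <= k')%:R : int)) //; last exact: ltnW.
  by rewrite -val_eqE /=; case: (ltngtP k k').
move=> vD; rewrite -[v]mulmx1 -intmx1 -DE intmx_mul mulmxA vD mul0mx //.
Qed.

Lemma gramA_quad m (v : 'rV[rat]_m) : v *m gramA m *m v^T =
  2^-1 *: ((v *m intmx (simple_roots m)) *m (v *m intmx (simple_roots m))^T).
Proof.
by rewrite gramA_simple_roots -scalemxAr -scalemxAl intmx_mul intmx_tr trmx_mul !mulmxA.
Qed.

Lemma gramA_psd m : psd (gramA m).
Proof. by move=> v; rewrite gramA_quad mxE mulr_ge0 ?dot_ge0. Qed.

Lemma gramA_def m (v : 'rV[rat]_m) : (v *m gramA m *m v^T) 0 0 = 0 -> v = 0.
Proof.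
rewrite gramA_quad mxE => /eqP; rewrite mulf_eq0 /= => /eqP /dot_eq0.
exact: simple_roots_free.
Qed.

Lemma gramA_unit m : gramA m \in unitmx.
Proof.
rewrite -row_free_unit; apply: inj_row_free => v v0; apply: gramA_def.
by rewrite v0 mul0mx mxE.
Qed.

Lemma gram_tr n (le : rel 'I_n) : (gram le)^T = gram le.
Proof.
by apply/matrixP => i j; rewrite !mxE addrC.
Qed.

(* The rows of [Q] are the coordinates, over the simple roots, of a root
   realisation of the poset in which the points [f i] form a Z-basis. *)
Section Realize.
Variables (n m : nat) (le : rel 'I_n) (f : 'I_m -> 'I_n) (Q : 'M[int]_(n, m)).
Hypotheses (m_gt0 : (0 < m)%N) (f_inj : injective f).
Hypothesis gramQ : gram le = intmx Q *m gramA m *m (intmx Q)^T.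
Hypothesis Qf_unit : rowsub f Q \in unitmx.

Let B := (rowsub f Q)^T.
(** The coordinates of all points over the basis formed by the points [f i]. *)
Let P := Q *m invmx (rowsub f Q).
Let G' : 'M[rat]_m := \matrix_(i, j) gram le (f i) (f j).

Lemma realize_nonneg : nonneg le.
Proof.
move=> v; rewrite gramQ.
have := gramA_psd (v *m intmx Q).
by rewrite trmx_mul !mulmxA.
Qed.

Let G'E : G' = (intmx B)^T *m gramA m *m intmx B.
Proof.
rewrite /B intmx_tr trmxK.
have -> : intmx (rowsub f Q) = rowsub f (intmx Q) by apply/matrixP => i j; rewrite !mxE.
by rewrite trmx_mxsub mul_rowsub_mx -mxsub_mul -gramQ; apply/matrixP => i j; rewrite !mxE.
Qed.

Let PB : P *m rowsub f Q = Q.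
Proof. by rewrite /P mulmxKV. Qed.

Let Pf i j : P (f i) j = (i == j)%:R.
Proof.
have -> : P (f i) j = (rowsub f P) i j by rewrite [RHS]mxE.
by rewrite /P -mul_rowsub_mx mulmxV // mxE.
Qed.

Let gramP : gram le = intmx P *m G' *m (intmx P)^T.
Proof.
rewrite G'E gramQ -{1 2}PB !intmx_mul /B !intmx_tr trmxK trmx_mul !mulmxA //.
Qed.

Let G'unit : G' \in unitmx.
Proof.
have U : intmx B \in unitmx by rewrite unitmxE det_map_mx rmorph_unit // -unitmxE unitmx_tr.
by rewrite G'E !unitmx_mul unitmx_tr gramA_unit U.
Qed.

Let m_le_n : (m <= n)%N.
Proof. by have := leq_card f f_inj; rewrite !card_ord. Qed.

(** The Gram matrix factors through the invertible [G'] of size [m] and contains it as a submatrix,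
    so both have rank [m]. *)
Lemma realize_crk : crk le = (n - m)%N.
Proof.
rewrite /crk; congr (_ - _)%N; apply/eqP; rewrite eqn_leq; apply/andP; split.
  rewrite gramP; apply: leq_trans (mxrankM_maxl _ _) _.
  by apply: leq_trans (mxrankM_maxr _ _) _; rewrite mxrank_unit.
rewrite -{1}(mxrank_unit G'unit).
have -> : G' = rowsub f 1%:M *m gram le *m (rowsub f 1%:M)^T.
  rewrite -rowsubE trmx_mxsub trmx1 -mxsub_mul mulmx1.
  by apply/matrixP => i j; rewrite !mxE.
by apply: leq_trans (mxrankM_maxl _ _) _; apply: mxrankM_maxr.
Qed.

Lemma realize_DynA : DynA le m.
Proof.
split=> //; split; first by rewrite realize_crk subnKC.
pose K := ~: (f @: [set: 'I_m]).
have fK i : f i \notin K by rewrite inE negbK imset_f.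
have notK k : k \notin K -> exists i, k = f i.
  by rewrite inE negbK => /imsetP [i _ ->]; exists i.
(* The relation that expands the point [k] over the basis points; it lies in the radical. *)
pose h k : 'rV[int]_n := delta_mx 0 k - \sum_i P k i *: delta_mx 0 (f i).
have hE k x : h k 0 x = (x == k)%:R - \sum_i P k i * (x == f i)%:R.
  by rewrite !mxE summxE; congr (_ - _); apply: eq_bigr => i _; rewrite !mxE.
have hf k i : k \in K -> h k 0 (f i) = - P k i.
  move=> kK; rewrite hE; case: eqP => [E|_]; first by move: kK; rewrite -E (negbTE (fK i)).
  rewrite sub0r (bigD1 i) //= eqxx mulr1 big1 ?addr0 // => j ji.
  by rewrite (inj_eq f_inj) eq_sym (negbTE ji) mulr0.
have hK k x : x \in K -> h k 0 x = (x == k)%:R.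
  move=> xK; rewrite hE big1 ?subr0 // => i _.
  by case: eqP => [E|]; [move: xK; rewrite E (negbTE (fK i)) | rewrite mulr0].
have rowfP i : row (f i) P = delta_mx 0 i.
  by apply/rowP => j; rewrite [LHS]mxE Pf [RHS]mxE eqxx eq_sym.
have hP k : h k *m P = 0.
  rewrite mulmxBl -rowE mulmx_suml [row k P]row_sum_delta -sumrB big1 // => i _.
  by rewrite [row _ _ _ _]mxE -scalemxAl -rowE rowfP subrr.
exists K, h; split.
- by rewrite cardsCs setCK card_imset // cardsT !card_ord realize_crk.
- move=> k kK; rewrite /qform gramP !mulmxA -intmx_mul hP.
  by rewrite intmx0 !mul0mx mxE.
- by move=> k k' kK k'K; rewrite hK // eq_sym.
- move=> v; rewrite /qform gramQ !mulmxA => v0.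
  (* Since [gramA] is definite, an isotropic vector is a linear relation between the realised roots.
     Its entries on [K] serve as coefficients, and [v P = 0] determines the remaining entries. *)
  have vQ : v *m Q = 0.
    apply: intmx_inj; rewrite intmx_mul intmx0; apply: gramA_def.
    by rewrite trmx_mul !mulmxA.
  have vP : v *m P = 0 by rewrite /P mulmxA vQ mul0mx.
  exists (fun k => v 0 k); apply/rowP => x; rewrite summxE.
  under eq_bigr do rewrite mxE.
  case: (boolP (x \in K)) => [xK|/notK [i ->]].
    rewrite (bigD1 x) //= big1 => [|k /andP [kK kx]].
      by rewrite hK // eqxx mulr1 addr0.
    by rewrite hK // eq_sym (negbTE kx) mulr0.
  under eq_bigr => k kK do rewrite hf // mulrN.
  have /rowP /(_ i) := vP; rewrite !mxE (bigID (mem K)) /= => /eqP.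
  rewrite addr_eq0 => /eqP E; rewrite sumrN E opprK.
  rewrite (bigD1 (f i)) //= Pf eqxx mulr1 big1 ?addr0 // => k /andP [/notK [j ->]].
  by rewrite (inj_eq f_inj) Pf => /negbTE ->; rewrite mulr0.
- exists f; split=> //; exists B; split=> //.
  by rewrite unitmx_tr.
Qed.

End Realize.

(** * Zigzags *)

(* The coordinates of [e_a - e_b] over the simple roots. *)
Definition seg m a b : 'rV[int]_m := \row_k (a <= k < b)%:R.

(** The consecutive simple roots from [a] to [b - 1] telescope. *)
Lemma seg_simple_roots m a b : (a <= b <= m)%N ->
  seg m a b *m simple_roots m = \row_l ((l == a :> nat)%:R - (l == b :> nat)%:R).
Proof.
move=> /andP [ab bm]; rewrite -(subnKC ab) in bm *.
elim: (b - a)%N bm => [|d IH] bm.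
  apply/rowP => l; rewrite addn0 !mxE subrr big1 // => k _.
  by rewrite !mxE; case: andP => [[]|]; [lia | rewrite mul0r].
have dm : (a + d < m)%N by lia.
have -> : seg m a (a + d.+1) = seg m a (a + d) + delta_mx 0 (Ordinal dm).
  apply/rowP => k; rewrite !mxE eqxx /= -val_eqE /= -natrD; congr _%:R.
  by case: ltngtP; case: ltngtP; lia.
rewrite mulmxDl IH; [|exact: ltnW]; rewrite -rowE; apply/rowP => l; rewrite !mxE /= addnS.
by rewrite addrA subrK.
Qed.

Lemma dot_seg m a b c d : (a <= b <= m)%N -> (c <= d <= m)%N ->
  (seg m a b *m simple_roots m *m (seg m c d *m simple_roots m)^T) 0 0 =
  (a == c)%:R + (b == d)%:R - (a == d)%:R - (b == c)%:R.
Proof.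
move=> abm cdm; rewrite !seg_simple_roots // mxE.
under eq_bigr do rewrite 3!mxE.
rewrite (sum_delta2 (fun l => (l == c)%:R - (l == d)%:R : int)); lia.
Qed.

(** Both Gram matrices carry the factor 1/2; clearing it leaves an identity of integer matrices,
    tested entry by entry. *)
Lemma gram_simple_roots n m (le : rel 'I_n) (Q : 'M[int]_(n, m)) :
  (forall x y, (row x Q *m simple_roots m *m (row y Q *m simple_roots m)^T) 0 0
     = (le x y)%:R + (le y x)%:R) <->
  gram le = intmx Q *m gramA m *m (intmx Q)^T.
Proof.
set D := simple_roots m.
have rhsE : intmx Q *m gramA m *m (intmx Q)^T = 2^-1 *: intmx (Q *m D *m (Q *m D)^T).
  rewrite gramA_simple_roots -scalemxAr -scalemxAl trmx_mul !intmx_mul !intmx_tr.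
  by rewrite !mulmxA.
have entry x y : (row x Q *m D *m (row y Q *m D)^T) 0 0 = (Q *m D *m (Q *m D)^T) x y.
  by rewrite -!row_mul tr_row !mxE; apply: eq_bigr => k _; rewrite !mxE.
rewrite rhsE; split=> [H|].
  congr (_ *: intmx _); apply/matrixP => x y.
  by rewrite -entry H !mxE.
move=> /(congr1 (fun A => 2 *: A)).
rewrite /gram !scalerA mulfV // !scale1r => /intmx_inj E x y.
by rewrite entry -E !mxE.
Qed.

Section Zigzag.
Variable up : nat -> bool.

(* Encodes the walk whose step into its [k]-th point goes up iff [up k]; the
   steps into point [0] and out of the last point are virtual.  A monotone run
   is a star of the root tree; [zpar j] is the centre of the star of the step
   into [j], and the point [j] is the root
   [zsgn j *: (e_(zpar j) - e_(j+1))]. *)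
Definition turn i := up i != up i.+1.

Fixpoint zpar i := if i is j.+1 then (if turn j then j.+1 else zpar j) else 0%N.

Definition zsgn i : int := if up i then -1 else 1.

(** The steps from point [i] to a later point [j] are those numbered [i.+1] to [j], so comparability
    of the two points is [mono i.+1 j]. *)
Definition mono i j := [forall k : 'I_j.+1, (i <= k)%N ==> (up k == up i)].

Lemma monoP i j : reflect (forall k, (i <= k <= j)%N -> up k = up i) (mono i j).
Proof.
apply: (iffP forallP) => [M k /andP [ik kj]|M k].
  by have := M (Ordinal (kj : k < j.+1)%N); rewrite /= ik => /eqP.
by apply/implyP => ik; apply/eqP/M; rewrite ik -ltnS ltn_ord.
Qed.

Lemma mono_refl i : mono i i.
Proof. by apply/monoP => k ki; congr up; lia. Qed.

Lemma zpar_le i : (zpar i <= i)%N.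
Proof. by elim: i => //= i; case: turn => //; lia. Qed.

Lemma zsgnS i : zsgn i.+1 = if turn i then - zsgn i else zsgn i.
Proof. by rewrite /turn /zsgn; do 2 case: up. Qed.

Lemma zsgn2 i : zsgn i * zsgn i = 1.
Proof. by rewrite /zsgn; case: up. Qed.

Lemma mono_turn i j : (i <= j)%N -> turn j -> mono i j.+1 = false.
Proof.
move=> ij tj; apply/negP => /monoP M; move/negP: tj; apply.
by rewrite !M //; lia.
Qed.

Lemma mono_no_turn i j : (i <= j)%N -> ~~ turn j -> mono i j.+1 = mono i j.
Proof.
rewrite negbK => ij /eqP tj; apply/monoP/monoP => M k kij; first by apply: M; lia.
case: (eqVneq k j.+1) => [->|nk]; last by apply: M; lia.
by rewrite -tj; apply: M; lia.
Qed.

(** The left side is the inner product of the roots of [i] and [j]; the terms in [e_(j+1)] vanish.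
    By induction on [j], nothing changes while the run continues, and a turn creates a new centre,
    which lies on no earlier root except the one just before it. *)
Lemma zigzag_dot i j : (i < j)%N ->
  zsgn i * zsgn j * ((zpar i == zpar j)%:R - (i.+1 == zpar j)%:R) = (mono i.+1 j)%:R.
Proof.
move=> ij; rewrite -(subnKC ij); elim: (j - i.+1)%N => [|d IH].
  rewrite addn0 zsgnS mono_refl; have zi := zpar_le i.
  (* Consecutive points: at a turn they meet in the vertex [i.+1] with opposite orientations and
     opposite signs, otherwise they share their centre. *)
  rewrite /=; case: ifP => ti.
    have -> : (zpar i == i.+1) = false by lia.
    by rewrite eqxx mulrN zsgn2.
  have -> : (i.+1 == zpar i) = false by lia.
  by rewrite eqxx zsgn2.
rewrite addnS zsgnS; case: (boolP (turn (i.+1 + d))) => tj.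
  rewrite mono_turn ?leq_addr //= tj.
  have -> : (zpar i == (i + d).+2) = false by have := zpar_le i; lia.
  have -> : (i.+1 == (i + d).+2) = false by lia.
  by rewrite subrr mulr0.
by rewrite mono_no_turn ?leq_addr // -IH [zpar (i.+1 + d).+1]/= (negbTE tj).
Qed.

(** The centre stays [0] and the sign stays [zsgn 0] until the first turn; all later centres are
    positive. *)
Lemma zigzag_first j : zsgn j * (zpar j == 0%N)%:R = zsgn 0 * (mono 0 j)%:R.
Proof.
elim: j => [|j IH]; first by rewrite mono_refl.
rewrite zsgnS; case: (boolP (turn j)) => tj.
  by rewrite mono_turn //= tj !mulr0.
by rewrite mono_no_turn /= ?(negbTE tj).
Qed.

(** The form in which [zigzag_dot] is used at the virtual last step, where [j] has a centre and a
    sign but no root of its own. *)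
Lemma zigzag_last i j : (i < j)%N ->
  zsgn i * ((zpar i == zpar j)%:R - (i.+1 == zpar j)%:R) = zsgn j * (mono i.+1 j)%:R.
Proof.
move=> ij; rewrite -zigzag_dot // -!mulrA [zsgn j * _]mulrCA; congr (_ * _).
by rewrite mulrA zsgn2 mul1r.
Qed.

End Zigzag.

(** * Root realisations of paths and of cycles closed by one point *)

Section ZigzagRealize.
Variables (n l : nat) (le : rel 'I_n) (p : nat -> 'I_n) (up : nat -> bool).
Local Notation m := l.+1.
Hypothesis le_refl : reflexive le.
Hypothesis p_inj : forall i j, (i < m)%N -> (j < m)%N -> p i = p j -> i = j.
Hypothesis p_comp : forall i j, (i < j < m)%N ->
  (le (p i) (p j) + le (p j) (p i) = mono up i.+1 j)%N.
(** Treats both shapes at once: vacuous when the walk covers the poset, and otherwise a description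
    of the single point that closes it into a cycle. *)
Hypothesis p_out : forall z, (forall j, (j < m)%N -> p j <> z) ->
  [/\ forall x, (forall j, (j < m)%N -> p j <> x) -> x = z, up 0 = false, up m &
      forall j, (j < m)%N -> (le (p j) z + le z (p j) = mono up 0 j + mono up j.+1 m)%N].

Let f (i : 'I_m) := p i.
Let Qp j : 'rV[int]_m := zsgn up j *: seg m (zpar up j) j.+1.
(* A point [z] off the walk closes it into a cycle: its root joins the centres
   of the first and the last run.  The virtual steps go down from [z] and up
   to [z]. *)
Let Q : 'M[int]_(n, m) := \matrix_x
  (if [pick j : 'I_m | p j == x] is Some j then Qp j else seg m 0 (zpar up m)).

Let rowQp j : (j < m)%N -> row (p j) Q = Qp j.
Proof.
move=> jm; rewrite rowK; case: pickP => [k /eqP /p_inj -> //|].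
by move=> /(_ (Ordinal jm)); rewrite eqxx.
Qed.

Let rowQz z : (forall j, (j < m)%N -> p j <> z) -> row z Q = seg m 0 (zpar up m).
Proof.
by move=> H; rewrite rowK; case: pickP => // j /eqP /H; case; apply: ltn_ord.
Qed.

Let dot (u v : 'rV[int]_m) := (u *m simple_roots m *m (v *m simple_roots m)^T) 0 0.

Let dotC u v : dot u v = dot v u.
Proof. by rewrite /dot !mxE; apply: eq_bigr => k _; rewrite ![_^T _ _]mxE mulrC. Qed.

Let dotZl a u v : dot (a *: u) v = a * dot u v.
Proof. by rewrite /dot -!scalemxAl mxE. Qed.

Let dotZr a u v : dot v (a *: u) = a * dot v u.
Proof. by rewrite dotC dotZl dotC. Qed.

Let dot_pp i j : (i < j < m)%N -> dot (Qp i) (Qp j) = (mono up i.+1 j)%:R.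
Proof.
move=> /andP [ij jm]; have zi := zpar_le up i; have zj := zpar_le up j.
rewrite /Qp dotZl dotZr /dot dot_seg; try lia.
rewrite -(zigzag_dot up ij) mulrA eqSS (ltn_eqF ij).
have -> : (zpar up i == j.+1) = false by lia.
by rewrite subr0 addr0.
Qed.

Let dot_pp1 i : (i < m)%N -> dot (Qp i) (Qp i) = 2.
Proof.
move=> im; have zi := zpar_le up i.
rewrite /Qp dotZl dotZr /dot dot_seg; try lia.
have -> : (zpar up i == i.+1) = false by lia.
have -> : (i.+1 == zpar up i) = false by lia.
by rewrite !eqxx mulrA zsgn2.
Qed.

(** Against the root [e_0 - e_(zpar m)] of [z], the end [0] contributes the first-run identity and
    the end [zpar m] the last-run one; the directions of the virtual steps make both signs
    positive. *)
Let dot_pz z j : (forall j, (j < m)%N -> p j <> z) -> (j < m)%N ->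
  dot (Qp j) (seg m 0 (zpar up m)) = (mono up 0 j)%:R + (mono up j.+1 m)%:R.
Proof.
move=> Hz jm; have [_ u0 ul _] := p_out Hz.
have zj := zpar_le up j; have zl := zpar_le up m.
have := zigzag_first up j; have := zigzag_last up jm.
rewrite /Qp dotZl /dot dot_seg; try lia.
rewrite {2}/zsgn ul {3}/zsgn u0 mul1r mulN1r => E1 E2.
rewrite -E2 -[(mono up j.+1 m)%:R]opprK -E1.
by rewrite -mulrN -mulrDr; congr (_ * _); rewrite /=; ring.
Qed.

Let dot_zz z : (forall j, (j < m)%N -> p j <> z) ->
  dot (seg m 0 (zpar up m)) (seg m 0 (zpar up m)) = 2.
Proof.
move=> Hz; have [_ u0 ul _] := p_out Hz.
have zl := zpar_le up m.
rewrite /dot dot_seg; try lia.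
(* The virtual steps go in opposite directions, so there is a turn and the first and last centres
   differ. *)
have z0 : (zpar up m == 0%N) = false.
  apply/negP => /eqP E; have := zigzag_first up m.
  by rewrite E {1}/zsgn ul /zsgn u0; case: mono.
by rewrite [(0 == zpar up m)%N]eq_sym z0 !eqxx.
Qed.

Let gramQ : gram le = intmx Q *m gramA m *m (intmx Q)^T.
Proof.
apply/gram_simple_roots => x y; rewrite -/(dot _ _).
(* By symmetry, either [y] is off the walk or both points lie on it in walk order. *)
wlog: x y / (forall j, (j < m)%N -> p j <> y) \/
            exists i j, [/\ (i <= j < m)%N, x = p i & y = p j].
  move=> W.
  have dec u : (forall j, (j < m)%N -> p j <> u) \/ exists2 j, (j < m)%N & u = p j.
    case: (pickP [pred j : 'I_m | p j == u]) => [j /eqP <-|H]; [right | left].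
      by exists j.
    by move=> j jm /eqP E; have := H (Ordinal jm); rewrite /= E.
  case: (dec y) => [yo|[j jm yj]]; first by apply: W; left.
  case: (dec x) => [xo|[i im xi]].
    by rewrite dotC [RHS]addrC; apply: W; left.
  case: (leqP i j) => ij; first by apply: W; right; exists i, j; rewrite ij.
  by rewrite dotC [RHS]addrC; apply: W; right; exists j, i; rewrite (ltnW ij).
case=> [yo|[i [j [/andP [ij jm] -> ->]]]]; last first.
  rewrite !rowQp //; last lia.
  move: ij; rewrite leq_eqVlt => /orP [/eqP ->|ij].
    by rewrite dot_pp1 // le_refl.
  by rewrite dot_pp ?ij // -natrD p_comp ?ij.
have [Hx _ _ Hj] := p_out yo.
case: (pickP [pred j : 'I_m | p j == x]) => [j /eqP <-|H].
  by rewrite rowQp // rowQz // (dot_pz yo) // -!natrD Hj.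
have -> : x = y.
  by apply: Hx => j jm /eqP E; have := H (Ordinal jm); rewrite /= E.
by rewrite rowQz // (dot_zz yo) // le_refl.
Qed.

(** Row [j] is a signed segment ending at column [j], so the matrix is lower triangular with
    diagonal entries 1 or -1. *)
Let Qf_unit : rowsub f Q \in unitmx.
Proof.
have E i j : rowsub f Q i j = Qp i 0 j.
  have -> : rowsub f Q i j = row (p i) Q 0 j by rewrite [LHS]mxE [RHS]mxE.
  by rewrite rowQp.
rewrite unitmxE det_trig.
  apply: rpred_prod => i _; rewrite E !mxE zpar_le ltnSn mulr1.
  by rewrite /zsgn; case: up.
apply/is_trig_mxP => i j ij; rewrite E !mxE.
have -> : (zpar up i <= j < i.+1)%N = false by lia.
by rewrite mulr0.
Qed.

Lemma zigzag_realize : [/\ nonneg le, crk le = (n - m)%N & DynA le m].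
Proof.
have f_inj : injective f by move=> i j /p_inj E; apply: val_inj; apply: E.
split.
- exact: realize_nonneg gramQ.
- exact: realize_crk gramQ Qf_unit.
- exact: realize_DynA gramQ Qf_unit.
Qed.

End ZigzagRealize.

(** * Posets of type A *)

Lemma sum0_pos_entry N (w : 'I_N -> int) :
  \sum_l w l = 0 -> \sum_l w l * w l != 0 -> exists a, 0 < w a.
Proof.
move=> w0 nz; apply/existsP; apply: contraNT nz => /existsPn npos.
have neg l : true -> 0 <= - w l by rewrite oppr_ge0 leNgt npos.
have /eqP : \sum_l - w l = 0 by rewrite sumrN w0 oppr0.
rewrite psumr_eq0 // => /allP z; apply/eqP/big1 => l _.
by have := z l (mem_index_enum _); rewrite oppr_eq0 => /eqP ->; rewrite mul0r.
Qed.

(** A nonzero vector of sum zero has a positive and a negative entry; their squares already use up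
    the norm 2, so they are 1 and -1 and all other entries vanish. *)
Lemma root_shape N (w : 'I_N -> int) :
  \sum_l w l = 0 -> \sum_l w l * w l = 2 ->
  exists a c, forall l, w l = (l == a)%:R - (l == c)%:R.
Proof.
move=> w0 w2.
have [a apos] : exists a, 0 < w a by apply: sum0_pos_entry; rewrite ?w2.
have [c cpos] : exists c, 0 < - w c.
  apply: (sum0_pos_entry (w := fun l => - w l)); first by rewrite sumrN w0 oppr0.
  by under eq_bigr do rewrite mulrNN; rewrite w2.
have ca : c != a by apply/eqP => E; move: cpos; rewrite E; lia.
exists a, c; move: w2; rewrite (bigD1 a) //= (bigD1 c) //=.
set S := \sum_(_ | _) _ => w2.
have Sge0 : 0 <= S by apply: sumr_ge0 => l _; rewrite -expr2 sqr_ge0.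
have wa : w a = 1 by nia.
have wc : w c = -1 by nia.
have S0 : S == 0 by rewrite wa wc in w2; apply/eqP; lia.
move=> l; case: (eqVneq l a) => [->|la]; first by rewrite eq_sym (negbTE ca) wa.
case: (eqVneq l c) => [->|lc]; first by rewrite wc.
move: S0; rewrite psumr_eq0; last by move=> k _; rewrite -expr2 sqr_ge0.
move=> /allP /(_ l (mem_index_enum _)); rewrite la lc -expr2 sqrf_eq0 /=.
by move/eqP.
Qed.

(* The kernel vector [h k] expresses the point [k] as an integral combination
   of the points [f i], modulo the radical. *)
Lemma DynA_gram n m (le : rel 'I_n) : nonneg le -> DynA le m ->
  exists Q : 'M[int]_(n, m), gram le = intmx Q *m gramA m *m (intmx Q)^T.
Proof.
move=> nn [_ [mn [K [h [cardK q0 hK _ [f [f_inj fK [B [_ GB]]]]]]]]].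
have Kf : ~: K = f @: [set: 'I_m].
  apply/esym/eqP; rewrite eqEcard; apply/andP; split.
    by apply/subsetP => x /imsetP [i _ ->]; rewrite inE.
  by rewrite cardsCs setCK card_imset // cardsT !card_ord cardK; lia.
(* For [x] in [K], the kernel vector [h x] has entry 1 at [x] and 0 elsewhere on [K]; solving it for
   [x] gives these coefficients. *)
pose P : 'M[int]_(n, m) :=
  \matrix_(x, i) if x \in K then - h x 0 (f i) else (x == f i)%:R.
pose S := rowsub f (gram le).
have gramPS : gram le = intmx P *m S.
  apply/matrixP => x y; rewrite [RHS]mxE.
  case: (boolP (x \in K)) => xK; last first.
    have : x \in ~: K by rewrite inE.
    rewrite Kf => /imsetP [i _ xi]; rewrite (bigD1 i) //= big1 => [|j ji].
      by rewrite [intmx _ _ _]mxE [P _ _]mxE (negbTE xK) xi eqxx mul1r addr0 [S _ _]mxE.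
    rewrite [intmx _ _ _]mxE [P _ _]mxE (negbTE xK) xi (inj_eq f_inj).
    by rewrite eq_sym (negbTE ji) mul0r.
  have /rowP /(_ y) := psd_radical nn (gram_tr le) (q0 x xK).
  rewrite mxE [RHS]mxE (bigID (mem K)) /= (bigD1 x) //= [X in _ + X + _]big1; last first.
    by move=> k /andP [kK kx]; rewrite mxE hK // eq_sym (negbTE kx) mul0r.
  rewrite mxE hK // eqxx mul1r addr0 => /eqP; rewrite addr_eq0 => /eqP ->.
  have -> : \sum_(k | k \notin K) intmx (h x) 0 k * gram le k y =
            \sum_(k in ~: K) intmx (h x) 0 k * gram le k y.
    by apply: eq_bigl => k; rewrite inE.
  rewrite Kf big_imset /=; last by move=> i j _ _; apply: f_inj.
  rewrite -sumrN; apply: eq_big => [i|i _]; first by rewrite inE.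
  by rewrite [intmx P _ _]mxE [P _ _]mxE xK rmorphN [S _ _]mxE mulNr [intmx _ _ _]mxE.
exists (P *m B^T).
(* By symmetry the factorisation through [P] applies to the columns as well. *)
have ST : S = (intmx B)^T *m gramA m *m intmx B *m (intmx P)^T.
  rewrite -GB; have -> : S = (colsub f (gram le))^T.
    by rewrite trmx_mxsub gram_tr.
  rewrite [in LHS]gramPS -mulmx_colsub trmx_mul; congr (_ *m _).
  by rewrite /S; apply/matrixP => i j; rewrite !mxE addrC.
by rewrite {1}gramPS ST intmx_mul !trmx_mul intmx_tr trmxK !mulmxA.
Qed.

(** In the realisation every point has coordinate sum zero and, by reflexivity, norm 2, so
    [root_shape] applies. *)
Lemma DynA_roots n m (le : rel 'I_n) : reflexive le -> nonneg le -> DynA le m ->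
  exists a c : 'I_n -> 'I_m.+1, forall x y,
    (a x == a y)%:R + (c x == c y)%:R - (a x == c y)%:R - (c x == a y)%:R
      = (le x y)%:R + (le y x)%:R :> int.
Proof.
move=> lexx nn D; have [Q /gram_simple_roots dotQ] := DynA_gram nn D.
pose w x (l : 'I_m.+1) := (row x Q *m simple_roots m) 0 l.
have dotw x y : \sum_l w x l * w y l = (le x y)%:R + (le y x)%:R.
  by rewrite -dotQ mxE; apply: eq_bigr => l _; rewrite [_^T _ _]mxE.
have sumw x : \sum_l w x l = 0.
  under eq_bigr do rewrite /w mxE.
  rewrite exchange_big big1 //= => k _; rewrite -mulr_sumr.
  under eq_bigr do rewrite mxE -[_ - _]mulr1.
  by rewrite (sum_delta2 (fun=> 1)) ?subrr ?mulr0 // ltnW.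
have /fin_all_exists [a /fin_all_exists [c ac]] :
    forall x, exists a c, forall l, w x l = (l == a)%:R - (l == c)%:R.
  by move=> x; apply: root_shape; rewrite // dotw lexx.
exists a, c => x y; rewrite -dotw.
under eq_bigr do rewrite !ac -!val_eqE.
rewrite (sum_delta2 (fun l => (l == a y :> nat)%:R - (l == c y :> nat)%:R : int));
  try by rewrite -ltnS ltn_ord.
by rewrite -!val_eqE /=; ring.
Qed.

(* The points are edges [(a x, c x)] of a graph and comparability is adjacency
   of edges, i.e. the comparability graph is a line graph. *)
Section LineGraph.
Variables (n : nat) (le : rel 'I_n) (N : nat) (a c : 'I_n -> 'I_N).
Hypothesis Hposet : is_poset le.
Hypothesis dot_ac : forall x y,
    (a x == a y)%:R + (c x == c y)%:R - (a x == c y)%:R - (c x == a y)%:R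
      = (le x y)%:R + (le y x)%:R :> int.

Let comp x y := le x y || le y x.

Let ac_neq x : a x <> c x.
Proof.
case: Hposet => lexx _ _; move=> E.
by have := dot_ac x x; rewrite lexx E !eqxx.
Qed.

(** The inner product is 1. Two positive coincidences would need a negative one to compensate, which
    would identify the ends of a single root. *)
Let comp_shared x y : x != y -> comp x y ->
  a x = a y /\ c x <> c y \/ a x <> a y /\ c x = c y.
Proof.
case: Hposet => lexx lea _ nxy cxy.
have : (le x y)%:R + (le y x)%:R = 1 :> int.
  move: cxy nxy; rewrite /comp; case xy: (le x y); case yx: (le y x) => //= _.
  by rewrite (lea x y) ?eqxx // xy.
rewrite -dot_ac; have ax := @ac_neq x; have ay := @ac_neq y.
case: (a x =P a y) => E1; case: (c x =P c y) => E2; [|by left|by right|];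
  by case: (_ =P _) => E3; case: (_ =P _) => E4 //=; congruence.
Qed.

(** The inner product is 0, and a positive coincidence cannot be cancelled without identifying the
    ends of a single root. *)
Let incomp_disjoint x y : ~~ comp x y -> a x <> a y /\ c x <> c y.
Proof.
rewrite /comp negb_or => /andP [/negbTE xy /negbTE yx].
have := dot_ac x y; rewrite xy yx /=; have ax := @ac_neq x; have ay := @ac_neq y.
by case: (a x =P a y) => E1; case: (c x =P c y) => E2;
   case: (a x =P c y) => E3; case: (c x =P a y) => E4 //=; congruence.
Qed.

Lemma claw_free x y1 y2 y3 :
  x != y1 -> x != y2 -> x != y3 -> comp x y1 -> comp x y2 -> comp x y3 ->
  ~~ comp y1 y2 -> ~~ comp y1 y3 -> ~~ comp y2 y3 -> False.
Proof.
move=> n1 n2 n3 /(comp_shared n1) c1 /(comp_shared n2) c2 /(comp_shared n3) c3.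
by move=> /incomp_disjoint [? ?] /incomp_disjoint [? ?] /incomp_disjoint [? ?];
   case: c1 => -[? ?]; case: c2 => -[? ?]; case: c3 => -[? ?]; congruence.
Qed.

(** Say [x] and [z] share the end [a]. Being incomparable, [y1] and [y2] meet [x] in different ends;
    the one sharing [c x] can share neither [a z] nor [c z]. *)
Lemma diamond_free x z y1 y2 :
  x != z -> x != y1 -> x != y2 -> z != y1 -> z != y2 -> comp x z ->
  comp x y1 -> comp x y2 -> comp z y1 -> comp z y2 -> ~~ comp y1 y2 -> False.
Proof.
move=> n1 n2 n3 n4 n5 /(comp_shared n1) c1 /(comp_shared n2) c2 /(comp_shared n3) c3.
move=> /(comp_shared n4) c4 /(comp_shared n5) c5 /incomp_disjoint [? ?].
by case: c1 => -[? ?]; case: c2 => -[? ?]; case: c3 => -[? ?];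
   case: c4 => -[? ?]; case: c5 => -[? ?]; congruence.
Qed.

Let covers_incomp x y z :
  hasse_arrow le x y -> hasse_arrow le x z -> y != z -> ~~ comp y z.
Proof.
move=> xy xz yz; rewrite /comp negb_or (covers_incomparable xy xz yz).
by rewrite (covers_incomparable xz xy) // eq_sym.
Qed.

Let cocovers_incomp x y z :
  hasse_arrow le y x -> hasse_arrow le z x -> y != z -> ~~ comp y z.
Proof.
move=> xy xz yz; rewrite /comp negb_or (cocovers_incomparable xy xz yz).
by rewrite (cocovers_incomparable xz xy) // eq_sym.
Qed.

(** By transitivity [t] lies below [y] and [z], so [x] and [t] with the incomparable [y] and [z]
    form a diamond. *)
Let no_two_covers_one_cocover x y z t : y != z ->
  hasse_arrow le x y -> hasse_arrow le x z -> hasse_arrow le t x -> False.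
Proof.
case: Hposet => lexx lea let' yz xy xz tx.
have [[nxy nxz] ntx] := (hasse_arrow_neq xy, hasse_arrow_neq xz, hasse_arrow_neq tx).
have [[lxy lxz] ltx] := (hasse_arrow_le xy, hasse_arrow_le xz, hasse_arrow_le tx).
have H u : le x u -> x != u -> t != u.
  by move=> xu nxu; apply/eqP => E; move/eqP: nxu; apply; apply: lea; rewrite xu -E ltx.
apply: (@diamond_free x t y z) => //; rewrite /comp ?lxy ?lxz ?ltx ?orbT //.
- by rewrite eq_sym.
- exact: H.
- exact: H.
- by rewrite (let' _ _ _ ltx lxy).
- by rewrite (let' _ _ _ ltx lxz).
- exact: covers_incomp xy xz yz.
Qed.

Let no_two_cocovers_one_cover x y z t : y != z ->
  hasse_arrow le y x -> hasse_arrow le z x -> hasse_arrow le x t -> False.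
Proof.
case: Hposet => lexx lea let' yz yx zx xt.
have [[nyx nzx] nxt] := (hasse_arrow_neq yx, hasse_arrow_neq zx, hasse_arrow_neq xt).
have [[lyx lzx] lxt] := (hasse_arrow_le yx, hasse_arrow_le zx, hasse_arrow_le xt).
have H u : le u x -> u != x -> t != u.
  by move=> ux nux; apply/eqP => E; move/eqP: nux; apply; apply: lea; rewrite ux -E lxt.
apply: (@diamond_free x t y z) => //; rewrite /comp ?lyx ?lzx ?lxt ?orbT //.
- by rewrite eq_sym.
- by rewrite eq_sym.
- exact: H.
- exact: H.
- by rewrite (let' _ _ _ lyx lxt) orbT.
- by rewrite (let' _ _ _ lzx lxt) orbT.
- exact: cocovers_incomp yx zx yz.
Qed.

(** Three neighbours on the same side of [x] form a claw; a mixed triple gives a diamond. *)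
Lemma hasse_degree_le2 x : (#|hasse_adj le x| <= 2)%N.
Proof.
rewrite leqNgt; apply/negP => /card_gt2P [y1 [y2 [y3 [[i1 i2 i3] [n12 n23 n31]]]]].
have n21 : y2 != y1 by rewrite eq_sym.
have n32 : y3 != y2 by rewrite eq_sym.
have n13 : y1 != y3 by rewrite eq_sym.
have up y : hasse_arrow le x y -> x != y /\ comp x y.
  by move=> h; rewrite (hasse_arrow_neq h) /comp (hasse_arrow_le h).
have down y : hasse_arrow le y x -> x != y /\ comp x y.
  by move=> h; rewrite eq_sym (hasse_arrow_neq h) /comp (hasse_arrow_le h) orbT.
case/orP: i1 => h1; case/orP: i2 => h2; case/orP: i3 => h3.
- have [[[? ?] [? ?]] [? ?]] := (up _ h1, up _ h2, up _ h3).
  by apply: (@claw_free x y1 y2 y3) => //; apply: covers_incomp; eauto.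
- exact: no_two_covers_one_cocover n12 h1 h2 h3.
- exact: no_two_covers_one_cocover n13 h1 h3 h2.
- exact: no_two_cocovers_one_cover n23 h2 h3 h1.
- exact: no_two_covers_one_cocover n23 h2 h3 h1.
- exact: no_two_cocovers_one_cover n13 h1 h3 h2.
- exact: no_two_cocovers_one_cover n12 h1 h2 h3.
- have [[[? ?] [? ?]] [? ?]] := (down _ h1, down _ h2, down _ h3).
  by apply: (@claw_free x y1 y2 y3) => //; apply: cocovers_incomp; eauto.
Qed.

(** A unique sink [z] would be a maximum. A minimal point [x] has both its Hasse neighbours above
    it, and these are incomparable, so together with [x] and [z] they form a diamond. *)
Lemma two_regular_two_sinks :
  (0 < n)%N -> hasse_2regular le -> at_least_two_sinks le.
Proof.
case: Hposet => lexx lea let' n0 reg; rewrite /at_least_two_sinks leqNgt.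
apply/negP; rewrite ltnS => /card_le1_eqP sink1.
have [z sz _] := ex_sink Hposet (Ordinal n0).
have maxz x : le x z.
  have [y sy xy] := ex_sink Hposet x.
  by rewrite (sink1 y z) ?inE.
pose down x := #|[set u | le u x]|.
have [x _ xmin] := @arg_minnP _ (Ordinal n0) predT down isT.
have source y : ~~ hasse_arrow le y x.
  apply/negP => h; have := xmin y isT; rewrite leqNgt => /negP; apply.
  apply: proper_card; apply/properP; split.
    by apply/subsetP => u; rewrite !inE => uy; apply: let' uy (hasse_arrow_le h).
  exists x; rewrite !inE ?lexx //; apply/negP => xy.
  by move/eqP: (hasse_arrow_neq h); apply; apply: lea; rewrite xy hasse_arrow_le.
have /card_gt1P [y1 [y2 []]] : (1 < #|[set j | hasse_adj le x j]|)%N by rewrite reg.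
rewrite !inE /hasse_adj (negbTE (source y1)) (negbTE (source y2)) !orbF => h1 h2 n12.
have n21 : y2 != y1 by rewrite eq_sym.
have zy y y' : hasse_arrow le x y -> hasse_arrow le x y' -> y != y' -> z != y'.
  move=> h h' nyy'; apply/eqP => E.
  by have := covers_incomparable h h' nyy'; rewrite -E maxz.
have nxz : x != z.
  apply/eqP => E; have := hasse_arrow_neq h1; move/eqP; apply.
  by apply: lea; rewrite hasse_arrow_le //= E maxz.
apply: (@diamond_free x z y1 y2); rewrite /comp ?maxz ?orbT ?(hasse_arrow_neq h1) ?(hasse_arrow_neq h2)
  ?(hasse_arrow_le h1) ?(hasse_arrow_le h2) //.
- exact: zy h2 h1 n21.
- exact: zy h1 h2 n12.
- exact: covers_incomp h1 h2 n12.
Qed.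

End LineGraph.

(** * Paths and cycles *)

Section Walk.
Variables (n l : nat) (le : rel 'I_n) (p : nat -> 'I_n).
Local Notation m := l.+1.
Hypothesis Hposet : is_poset le.
Hypothesis p_inj : forall i j, (i < m)%N -> (j < m)%N -> p i = p j -> i = j.
Hypothesis p_adj : forall i j, (i < m)%N -> (j < m)%N ->
  hasse_adj le (p i) (p j) = (i.+1 == j) || (j.+1 == i).
Hypothesis p_cover : forall x, (exists2 k, (k < m)%N & x = p k) \/ is_sink le x.

(** The default values are the virtual steps: down into point [0] and up out of point [l]. *)
Let up k := if k is j.+1 then (m <= k)%N || le (p j) (p k) else false.

Let le_down k : (k.+1 < m)%N -> le (p k.+1) (p k) = ~~ up k.+1.
Proof.
case: Hposet => lexx lea _ km; rewrite /up leqNgt km /=.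
have : hasse_adj le (p k) (p k.+1) by rewrite p_adj ?eqxx //; lia.
case/orP => h; rewrite (hasse_arrow_le h).
  apply/negP => h'; have /p_inj : p k = p k.+1 by apply: lea; rewrite hasse_arrow_le.
  by lia.
apply/esym/negP => h'; have /p_inj : p k = p k.+1 by apply: lea; rewrite h' hasse_arrow_le.
by lia.
Qed.

Let arrow_step i j : (i < m)%N -> (j < m)%N -> hasse_arrow le (p i) (p j) ->
  j = i.+1 /\ up j \/ i = j.+1 /\ ~~ up i.
Proof.
move=> im jm h; have : hasse_adj le (p i) (p j) by rewrite /hasse_adj h.
rewrite p_adj // => /orP [] /eqP E; subst.
  by left; split=> //; rewrite /up (hasse_arrow_le h) orbT.
by right; split=> //; rewrite -le_down // hasse_arrow_le.
Qed.

(** Follow a chain of Hasse arrows from [p i] to [p j]: each arrow moves one place, forward along an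
    up step or backward along a down step. *)
Let le_walk i j : (i < m)%N -> (j < m)%N -> le (p i) (p j) ->
  (forall k, (i < k <= j)%N -> up k) /\ (forall k, (j < k <= i)%N -> ~~ up k).
Proof.
move=> im jm /(le_hasse_connect Hposet) /connectP [s].
elim: s i im => [|y s IH] i im /=.
  by move=> _ /p_inj E; have {}E := E jm im; split=> k; lia.
case/andP => iy ys jl.
have [k km yk] : exists2 k, (k < m)%N & y = p k.
  (* The chain stays on the walk, since it could not continue from a sink. *)
  case: (p_cover y) => // sy; case: s ys jl {IH} => [_ /= <-|w s]; first by exists j.
  by move: sy => /forallP /(_ w) /negbTE /= ->.
rewrite yk in iy ys jl; have [IHu IHd] := IH k km ys jl.
(* The chain cannot turn back, because the step just taken would have to go both up and down. *)
by case: (arrow_step im km iy) => -[E uk]; split=> t tr;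
   (case: (eqVneq t k) => [tk|nk]; [|]); (case: (eqVneq t i) => [ti|ni]; [|]);
   subst; rewrite ?uk //; try lia; try (apply: IHu; lia); try (apply: IHd; lia).
Qed.

Let walk_up i j : (i <= j < m)%N -> (forall k, (i < k <= j)%N -> up k) -> le (p i) (p j).
Proof.
case: Hposet => lexx _ let'.
elim: j => [|j IH] ij U; first by have -> : i = 0%N by lia.
case: (eqVneq i j.+1) => [->|nij]; first exact: lexx.
apply: (let' (p j)); first by apply: IH => [|k kij]; [lia | apply: U; lia].
have : up j.+1 by apply: U; lia.
by case/orP => //; lia.
Qed.

Let walk_down i j : (i <= j < m)%N -> (forall k, (i < k <= j)%N -> ~~ up k) -> le (p j) (p i).
Proof.
case: Hposet => lexx _ let'.
elim: j => [|j IH] ij U; first by have -> : i = 0%N by lia.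
case: (eqVneq i j.+1) => [->|nij]; first exact: lexx.
apply: (let' (p j)); last by apply: IH => [|k kij]; [lia | apply: U; lia].
by rewrite le_down ?U //; lia.
Qed.

Let p_comp i j : (i < j < m)%N ->
  (le (p i) (p j) + le (p j) (p i) = mono up i.+1 j)%N.
Proof.
case: Hposet => lexx lea _ ij.
have nji : p j <> p i by move/p_inj; lia.
case: (boolP (mono up i.+1 j)) => [/monoP M|nM].
  case u: (up i.+1).
    have pij : le (p i) (p j) by apply: walk_up => [|k kij]; rewrite ?M //; lia.
    rewrite pij; case pji: (le (p j) (p i)) => //.
    by case: nji; apply: lea; rewrite pij pji.
  have pji : le (p j) (p i) by apply: walk_down => [|k kij]; rewrite ?M ?u //; lia.
  rewrite pji; case pij: (le (p i) (p j)) => //.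
  by case: nji; apply: lea; rewrite pij pji.
case: (boolP (le (p i) (p j))) => [/le_walk [||U _]|_]; [lia|lia| |].
  by case/monoP: nM => k kij; rewrite !U //; lia.
case: (boolP (le (p j) (p i))) => [/le_walk [||_ U]|//]; [lia|lia|].
by case/monoP: nM => k kij; rewrite (negbTE (U k _)) ?(negbTE (U i.+1 _)) //; lia.
Qed.

Lemma path_realize : (forall x, exists2 k, (k < m)%N & x = p k) ->
  [/\ nonneg le, crk le = (n - m)%N & DynA le m].
Proof.
case: Hposet => lexx _ _ cov; apply: (zigzag_realize lexx p_inj p_comp).
by move=> z Hz; have [k km /esym /(Hz k km)] := cov z.
Qed.

(** * Cycles closed by a sink *)

Section Cycle.
Variable z : 'I_n.
Hypothesis z_sink : is_sink le z.
Hypothesis z_out : forall j, (j < m)%N -> p j <> z.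
Hypothesis z_cover : forall x, x = z \/ exists2 k, (k < m)%N & x = p k.
Hypothesis z_adj : forall j, (j < m)%N -> hasse_adj le (p j) z = (j == 0%N) || (j == l).
Hypothesis z_not_max : exists2 j, (j < m)%N & is_sink le (p j).

Let z_arrow j : (j < m)%N -> hasse_arrow le (p j) z = (j == 0%N) || (j == l).
Proof.
move=> jm; rewrite -z_adj // /hasse_adj.
by move: z_sink => /forallP /(_ (p j)) /negbTE ->; rewrite orbF.
Qed.

(** A chain of arrows to [z] must leave the walk at one of its two ends, and it moves monotonically
    until then. *)
Let z_walk j : (j < m)%N -> le (p j) z -> mono up 0 j \/ mono up j.+1 m.
Proof.
move=> jm /(le_hasse_connect Hposet) /connectP [s].
elim: s j jm => [|y s IH] j jm /=; first by move=> _ /esym /(z_out jm).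
case/andP => jy ys zl; case: (z_cover y) => [yz|[k km yk]].
  move: jy; rewrite yz z_arrow // => /orP [] /eqP ->; [left | right]; exact: mono_refl.
rewrite yk in jy ys zl; have upm : up m by rewrite /up leqnn.
case: (arrow_step jm km jy) => -[E uk]; [subst k | subst j]; case: (IH _ km ys zl) => /monoP M.
- have : up j.+1 = up 0 by apply: M; lia.
  by rewrite uk.
- right; apply/monoP => t tr; case: (eqVneq t j.+1) => [-> //|nt].
  have -> : up t = up j.+2 by apply: M; lia.
  have -> : up j.+2 = up m by rewrite M //; lia.
  by rewrite upm uk.
- left; apply/monoP => t tr; case: (eqVneq t k.+1) => [->|nt]; last by apply: M; lia.
  by rewrite (negbTE uk).
- have : up m = up k.+1 by apply: M; lia.
  by rewrite upm (negbTE uk).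
Qed.

Let z_comp j : (j < m)%N -> (le (p j) z + le z (p j) = mono up 0 j + mono up j.+1 m)%N.
Proof.
case: Hposet => lexx lea let' jm; have upm : up m by rewrite /up leqnn.
have -> : le z (p j) = false.
  by apply/negP => /(sink_max Hposet z_sink) /esym; apply: z_out.
have p0z : le (p 0) z by apply: hasse_arrow_le; rewrite z_arrow.
have plz : le (p l) z by apply: hasse_arrow_le; rewrite z_arrow // eqxx orbT.
have M0 : mono up 0 j -> le (p j) z.
  move=> /monoP M; apply: let' p0z; apply: walk_down => [|k kj]; first by lia.
  by rewrite M //; lia.
have M1 : mono up j.+1 m -> le (p j) z.
  move=> /monoP M; apply: let' plz; apply: walk_up => [|k kj]; first by lia.
  rewrite M; last by lia.
  by rewrite -(M m) //; lia.
have := z_walk jm; case: (boolP (mono up 0 j)) => m0; case: (boolP (mono up j.+1 m)) => m1.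
(* If both runs contained [j], the walk would descend to [p j] and then climb, putting all its
   points below [z]; the second sink excludes this. *)
- have [i im si] := z_not_max; exfalso.
  move/monoP: m0 => m0; move/monoP: m1 => m1.
  have ip : p i <> z := z_out im.
  case: (leqP i j) => ij.
    have := sink_max Hposet si.
    move=> /(_ z) E; apply: ip; apply: E.
    apply: let' p0z; apply: walk_down => [|k ki]; first by lia.
    by rewrite m0 //; lia.
  have := sink_max Hposet si.
  move=> /(_ z) E; apply: ip; apply: E.
  apply: let' plz; apply: walk_up => [|k ki]; first by lia.
  rewrite m1; last by lia.
  by rewrite -(m1 m) //; lia.
- by move=> _; rewrite M0.
- by move=> _; rewrite M1.
- by case: (boolP (le (p j) z)) => // _ H; case: (H isT).
Qed.

Lemma cycle_realize : [/\ nonneg le, crk le = (n - m)%N & DynA le m].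
Proof.
case: Hposet => lexx _ _; apply: (zigzag_realize lexx p_inj p_comp) => y Hy.
have yz : y = z by case: (z_cover y) => // -[k km /esym /(Hy k km)].
subst y; split=> //; last by rewrite /= leqnn.
by move=> x Hx; case: (z_cover x) => // -[k km /esym /(Hx k km)].
Qed.

End Cycle.
End Walk.

(** * The classification *)

Section Main.
Variables (n : nat) (le : rel 'I_n).
Hypotheses (Hposet : is_poset le) (Hconn : poset_connected le).

(** The enumeration starts at a sink [z]; the remaining points form the walk, and a second sink lies
    on it. *)
Lemma cycle_typeA : hasse_2regular le -> at_least_two_sinks le ->
  [/\ nonneg le, crk le = 1%N & DynA le n.-1].
Proof.
move=> reg /card_gt1P [z [z' [zs z's nzz']]].
rewrite !inE in zs z's.
have regE x : #|hasse_adj le x| = 2%N by rewrite -(reg x) cardsE.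
have [||s [Us ps alls adj]] := @degree_le2_enum _ _ z (hasse_adj_sym le) (hasse_adj_irr le) Hconn.
- by move=> x; rewrite regE.
- by right.
have sn : n = (size s).+1.
  by rewrite -[LHS]card_ord -[RHS]/(size (z :: s)) -(card_uniqP Us); apply: eq_card => x; rewrite alls.
have s2 : (1 < size s)%N.
  have : (#|hasse_adj le z| <= size s)%N.
    apply: leq_trans (card_size s); apply/subset_leq_card/subsetP => x zx.
    have := alls x; rewrite inE => /orP [/eqP xz|//].
    by move: zx; rewrite xz -[_ \in _]/(hasse_adj le z z) hasse_adj_irr.
  by rewrite regE.
have [l lE] : exists l, size s = l.+1 by exists (size s).-1; lia.
rewrite lE in sn s2 adj; pose q k := nth z (z :: s) k.
have q_inj i j : (i <= l.+1)%N -> (j <= l.+1)%N -> q i = q j -> i = j.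
  by move=> il jl /eqP; rewrite nth_uniq //= ?lE // => /eqP.
have qP x : exists2 k, (k <= l.+1)%N & x = q k.
  by have /(nthP z) [k] := alls x; rewrite /= lE ltnS => kl <-; exists k.
have q_step k : (k <= l)%N -> hasse_adj le (q k) (q k.+1).
  by move=> kl; move/(pathP z): ps; apply; rewrite lE.
have adjC := hasse_adj_sym le.
have q0adj k : (k <= l.+1)%N -> hasse_adj le z (q k) -> k = 1%N \/ k = l.+1.
  case: k => [|k] kl zk; first by move: zk; rewrite /q /= hasse_adj_irr.
  by case: (adj 0%N k.+1) => // -[]; auto.
(* Only [q 1] and [q l.+1] can be adjacent to [z], which has two neighbours, so the enumeration
   closes up. *)
have q_last : hasse_adj le z (q l.+1).
  have /card_gt1P [y1 [y2 []]] : (1 < #|[set j | hasse_adj le z j]|)%N by rewrite reg.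
  have [k1 kl1 ->] := qP y1; have [k2 kl2 ->] := qP y2; rewrite !inE => h1 h2 n12.
  case: (q0adj _ kl1 h1) => E1; last by rewrite -E1.
  case: (q0adj _ kl2 h2) => E2; last by rewrite -E2.
  by rewrite E1 E2 eqxx in n12.
have z_out j : (j < l.+1)%N -> q j.+1 <> z by move=> jl /(q_inj _ 0%N); lia.
have z_cover x : x = z \/ exists2 k, (k < l.+1)%N & x = q k.+1.
  by have [[|k] kl ->] := qP x; [left | right; exists k].
(* The shift by one skips [q 0 = z]. *)
have [] := @cycle_realize n l le (fun k => q k.+1) Hposet _ _ _ z zs z_out z_cover.
- by move=> i j il jl /q_inj; lia.
- have half i j : (i < j < l.+1)%N ->
    hasse_adj le (q i.+1) (q j.+1) = (i.+1 == j) || (j.+1 == i).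
    move=> ij; have -> : (j.+1 == i) = false by lia.
    rewrite orbF; apply/idP/eqP => [h|<-]; last by apply: q_step; lia.
    by case: (adj i.+1 j.+1) => //; lia.
  move=> i j il jl; case: (ltngtP i j) => ij.
  + by rewrite half ?ij.
  + by rewrite adjC half ?ij // orbC.
  + by rewrite ij hasse_adj_irr; lia.
- by move=> x; case: (z_cover x) => [->|]; [right | left].
- move=> j jl; rewrite adjC; apply/idP/orP => [h|[] /eqP ->].
  + by case: (q0adj j.+1 jl h) => E; [left | right]; apply/eqP; lia.
  + exact: (q_step 0%N).
  + exact: q_last.
- by case: (z_cover z') => [E|[k kl E]]; [rewrite E eqxx in nzz' | exists k; rewrite -?E].
move=> nn c D; split=> //; first by rewrite c sn; lia.
by have -> : n.-1 = l.+1 by rewrite sn.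
Qed.

Hypothesis n_gt0 : (0 < n)%N.

Lemma path_typeA : hasse_is_path le -> [/\ nonneg le, crk le = 0%N & DynA le n].
Proof.
case: n le n_gt0 Hposet => // l le' _ posl [p pE].
rewrite -(subnn l.+1); apply: (path_realize (p := fun k => p (inord k))) => //.
- by move=> i j im jm /perm_inj /(congr1 val); rewrite /= !inordK.
- by move=> i j im jm; rewrite pE /path_adj !inordK.
- by move=> x; left; exists (p^-1 x)%g; rewrite // inord_val permKV.
- by move=> x; exists (p^-1 x)%g; rewrite // inord_val permKV.
Qed.

(** All degrees are at most 2: either all equal 2, or the enumeration can start at a point of degree
    at most 1 and yields a path. *)
Lemma typeA_path_or_cycle m : nonneg le -> DynA le m ->
  hasse_is_path le \/ hasse_2regular le /\ at_least_two_sinks le.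
Proof.
move=> nn D; have lexx : reflexive le by case: Hposet.
have [a [c ac]] := DynA_roots lexx nn D.
have deg2 := hasse_degree_le2 Hposet ac.
case: (boolP [forall x, #|hasse_adj le x| == 2%N]) => [/forallP reg|].
  have reg' : hasse_2regular le by move=> x; rewrite cardsE; apply/eqP/reg.
  by right; split=> //; apply: two_regular_two_sinks Hposet ac n_gt0 reg'.
move=> /forallPn [z zdeg]; left.
have z1 : (#|hasse_adj le z| <= 1)%N by have := deg2 z; lia.
have [|s [Us ps alls adj]] :=
  @degree_le2_enum _ _ z (hasse_adj_sym le) (hasse_adj_irr le) Hconn deg2; first by left.
have sn : n = (size s).+1.
  by rewrite -[LHS]card_ord -[RHS]/(size (z :: s)) -(card_uniqP Us); apply: eq_card => x; rewrite alls.
pose q (k : 'I_n) := nth z (z :: s) k.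
have q_inj : injective q.
  move=> i j /eqP; rewrite nth_uniq //= -?sn ?ltn_ord // => /eqP; exact: val_inj.
exists (perm q_inj) => i j; rewrite !permE /path_adj.
have half (u v : 'I_n) : (u < v)%N ->
    hasse_adj le (q u) (q v) = (u.+1 == v) || (v.+1 == u).
  move=> uv; have -> : (v.+1 == u :> nat) = false by lia.
  have vs : (v <= size s)%N by rewrite -ltnS -sn.
  rewrite orbF; apply/idP/eqP => [h|E]; last first.
    by rewrite /q -E; move/(pathP z): ps; apply; rewrite E.
  case: (adj u v); rewrite ?uv //= => -[u0 vl].
  (* An edge joining the two ends is consecutive when there are only two points; otherwise it gives
     [z] a second neighbour. *)
  case: (eqVneq (size s) 1%N) => [s1|s1]; first by rewrite u0 vl s1.
  have : (1 < #|hasse_adj le z|)%N; last by lia.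
  apply/card_gt1P; exists (nth z (z :: s) 1), (q v); split.
  - by move/(pathP z): ps => /(_ 0%N); apply; lia.
  - by move: h; rewrite /q u0.
  - rewrite nth_uniq //=; [|lia].
    by rewrite eq_sym vl.
case: (ltngtP i j) => ij.
- exact: half.
- by rewrite hasse_adj_sym half // orbC.
- by rewrite (val_inj ij) hasse_adj_irr; lia.
Qed.

End Main.

Theorem theorem1p2 (n : nat) (le : rel 'I_n)
  (Hn : (0 < n)%N) (Hposet : is_poset le) (Hconn : poset_connected le) :
  [/\ (nonneg le /\ crk le = 0%N /\ DynA le n) <-> hasse_is_path le,
      (nonneg le /\ crk le = 1%N /\ DynA le n.-1) <->
        (hasse_2regular le /\ at_least_two_sinks le)
    & (nonneg le -> DynA le (n - crk le) -> (crk le <= 1)%N)].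
Proof.
(* Paths have corank 0 and cycles with two sinks corank 1, so in the forward directions the given
   corank selects the shape. *)
have P := path_typeA Hposet Hn.
have C := cycle_typeA Hposet Hconn.
split.
- split=> [[nn [c0 D]]|/P [? ? ?] //].
  case: (typeA_path_or_cycle Hposet Hconn Hn nn D) => // -[reg two].
  by have [_ c1 _] := C reg two; rewrite c0 in c1.
- split=> [[nn [c1 D]]|[reg two]]; last by case: (C reg two).
  case: (typeA_path_or_cycle Hposet Hconn Hn nn D) => // /P [_ c0 _].
  by rewrite c1 in c0.
- move=> nn D; case: (typeA_path_or_cycle Hposet Hconn Hn nn D) => [/P [_ -> _] //|].
  by case=> reg two; have [_ -> _] := C reg two.
Qed.
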